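(* Let $p$ be a prime, let $k\geq 1$ be an integer, and let $a_n^{(k)}$ ($n\geq 0$) be the Mahler coefficients of the $k$-fold iterate $\mathcal{S}^k$ of the $p$-adic shift, i.e. $\mathcal{S}^k(x)=\sum_{n=0}^\infty a_n^{(k)}\binom{x}{n}$ for all $x\in\mathbb{Z}_p$. Then: (i) $a_n^{(k)}=0$ for $0\leq n<p^k$; (ii) $a_n^{(k)}=1$ for $n=p^k$; (iii) for every integer $j\geq 0$, $p^j$ divides $a_n^{(k)}$ for all $n>jp^k-j+1$ (and so $|a_n^{(k)}|\leq 1/p^j$).
   Context: $|\cdot|$ denotes the $p$-adic absolute value on $\mathbb{Z}_p$, with $|p|=1/p$. The $p$-adic shift $\mathcal{S}:\mathbb{Z}_p\to\mathbb{Z}_p$: if $x=\sum_{i\geq 0} b_i p^i$ with $b_i\in\{0,1,\dots,p-1\}$, then $\mathcal{S}(x)=\sum_{i\geq 0} b_{i+1}p^i$. It is continuous. Mahler expansion: every continuous $T:\mathbb{Z}_p\to\mathbb{Z}_p$ can be written uniquely as a uniformly convergent series $T(x)=\sum_{n=0}^\infty a_n\binom{x}{n}$, with $a_n=\sum_{i=0}^n(-1)^{n+i}T(i)\binom{n}{i}\in\mathbb{Z}_p$. *)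

(* Defs.v *)
From HB Require Import structures.
From mathcomp Require Import all_boot all_order all_algebra.
From mathcomp Require Import all_classical all_reals all_analysis.

Set Implicit Arguments.
Unset Strict Implicit.
Unset Printing Implicit Defensive.

Import Order.TTheory GRing.Theory Num.Theory.
Local Open Scope classical_set_scope.
Local Open Scope ring_scope.

(* Z_p as the inverse limit of the rings Z/p^n: [x n] is the canonical
   representative (in [0, p^n) when p > 0) of x modulo p^n. The construction
   makes sense for every natural number p. *)
Record padic_int (p : nat) := PadicInt {
  residue :> nat -> int;
  residueP : forall n, (residue n.+1 %% p%:Z ^+ n)%Z = residue n }.

Section PadicInt.
Variable p : nat.
Implicit Types x y z : padic_int p.

Local Notation P n := (p%:Z ^+ n).

HB.instance Definition _ := gen_eqMixin (padic_int p).
HB.instance Definition _ := gen_choiceMixin (padic_int p).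

Lemma padic_ext x y : (forall n, x n = y n) -> x = y.
Proof.
case: x y => [x xP] [y yP] /= /funext exy; rewrite exy in xP *.
congr PadicInt; exact: Prop_irrelevance.
Qed.

Lemma residue_mod x n : (x n %% P n)%Z = x n.
Proof. by rewrite -(residueP x n) modz_mod. Qed.

Lemma modz_modX (a : int) m n : (n <= m)%N ->
  ((a %% P m)%Z %% P n)%Z = (a %% P n)%Z.
Proof.
move=> le_nm; apply/eqP; rewrite eqz_mod_dvd.
apply: (@dvdz_trans (P m)); first by rewrite dvdz_exp2l.
by rewrite -eqz_mod_dvd modz_mod.
Qed.

Lemma residue_modX x m n : (n <= m)%N -> (x m %% P n)%Z = x n.
Proof.
move/subnK <-; elim: (m - n)%N => [|k IHk]; first exact: residue_mod.
by rewrite -IHk addSn -[in RHS]residueP modz_modX // leq_addl.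
Qed.

Lemma padic_of_coherent_subproof (u : nat -> int)
    (uP : forall n, (u n.+1 = u n %[mod P n])%Z) n :
  ((u n.+1 %% P n.+1)%Z %% P n)%Z = (u n %% P n)%Z.
Proof. by rewrite modz_modX. Qed.

Definition padic_of_coherent (u : nat -> int)
    (uP : forall n, (u n.+1 = u n %[mod P n])%Z) : padic_int p :=
  PadicInt (padic_of_coherent_subproof uP).

Lemma residue_eqmod x n : (x n.+1 = x n %[mod P n])%Z.
Proof. by rewrite residueP residue_mod. Qed.

Definition padic_zero : padic_int p := padic_of_coherent (fun=> erefl (0 %% _)%Z).

Definition padic_one : padic_int p := padic_of_coherent (fun=> erefl (1 %% _)%Z).

Lemma padic_opp_subproof x n : (- x n.+1 = - x n %[mod P n])%Z.
Proof. by rewrite -modzNm residueP. Qed.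

Definition padic_opp x := padic_of_coherent (padic_opp_subproof x).

Lemma padic_add_subproof x y n :
  (x n.+1 + y n.+1 = x n + y n %[mod P n])%Z.
Proof. by rewrite -modzDm !residueP. Qed.

Definition padic_add x y := padic_of_coherent (padic_add_subproof x y).

Lemma padic_mul_subproof x y n :
  (x n.+1 * y n.+1 = x n * y n %[mod P n])%Z.
Proof. by rewrite -modzMm !residueP. Qed.

Definition padic_mul x y := padic_of_coherent (padic_mul_subproof x y).

Lemma padic_addA : associative padic_add.
Proof. by move=> x y z; apply: padic_ext => n /=; rewrite modzDmr modzDml addrA. Qed.

Lemma padic_addC : commutative padic_add.
Proof. by move=> x y; apply: padic_ext => n /=; rewrite addrC. Qed.

Lemma padic_add0 : left_id padic_zero padic_add.
Proof.
by move=> x; apply: padic_ext => n /=; rewrite modzDml add0r residue_mod.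
Qed.

Lemma padic_addN : left_inverse padic_zero padic_opp padic_add.
Proof. by move=> x; apply: padic_ext => n /=; rewrite modzDml addNr. Qed.

HB.instance Definition _ := GRing.isZmodule.Build (padic_int p)
  padic_addA padic_addC padic_add0 padic_addN.

Lemma padic_mulA : associative padic_mul.
Proof. by move=> x y z; apply: padic_ext => n /=; rewrite modzMmr modzMml mulrA. Qed.

Lemma padic_mulC : commutative padic_mul.
Proof. by move=> x y; apply: padic_ext => n /=; rewrite mulrC. Qed.

Lemma padic_mul1 : left_id padic_one padic_mul.
Proof.
by move=> x; apply: padic_ext => n /=; rewrite modzMml mul1r residue_mod.
Qed.

Lemma padic_mulDl : left_distributive padic_mul padic_add.
Proof.
by move=> x y z; apply: padic_ext => n /=; rewrite modzMml modzDm mulrDl.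
Qed.

HB.instance Definition _ := GRing.Zmodule_isComPzRing.Build (padic_int p)
  padic_mulA padic_mulC padic_mul1 padic_mulDl.

Lemma residue0 n : (0 : padic_int p) n = 0.
Proof. exact: mod0z. Qed.

Lemma residueD x y n : (x + y) n = ((x n + y n) %% P n)%Z.
Proof. by []. Qed.

Lemma residueN x n : (- x) n = ((- x n) %% P n)%Z.
Proof. by []. Qed.

Lemma residueM x y n : (x * y) n = ((x n * y n) %% P n)%Z.
Proof. by []. Qed.

Lemma residueB x y n : (x - y) n = ((x n - y n) %% P n)%Z.
Proof. by rewrite residueD residueN modzDmr. Qed.

Lemma residue_nat (m n : nat) :
  (m%:R : padic_int p) n = (m%:Z %% P n)%Z.
Proof.
elim: m => [|m IHm]; first by rewrite residue0 mod0z.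
by rewrite -addn1 natrD residueD IHm modzDm PoszD.
Qed.

Lemma residue_int (m : int) n : (m%:~R : padic_int p) n = (m %% P n)%Z.
Proof.
case: m => m; first exact: residue_nat.
by rewrite NegzE mulrNz residueN residue_nat modzNm.
Qed.

Lemma padic_eq0P x : reflect (exists n, x n.+1 != 0) (x != 0).
Proof.
apply: (iffP idP) => [x0|[n]]; last first.
  by apply: contra_neq => ->; exact: residue0.
apply: contrapT => x0'; case/eqP: x0; apply: padic_ext => n; rewrite residue0.
rewrite -residueP; case: (eqVneq (x n.+1) 0) => [->|xn]; first by rewrite mod0z.
by case: x0'; exists n.
Qed.

(* p^(-v), where v is the least n such that p^(n+1) does not divide x. *)
Definition padic_abs x : rat :=
  if pselect (exists n, x n.+1 != 0) is left x_neq0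
  then p%:R ^- ex_minn x_neq0 else 0.

Lemma padic_abs0 : padic_abs 0 = 0.
Proof.
by rewrite /padic_abs; case: pselect => // nz; exfalso; case: nz => n; rewrite residue0 eqxx.
Qed.

Lemma padic_absE x : x != 0 ->
  exists2 n, padic_abs x = p%:R ^- n
    & x n.+1 != 0 /\ forall m, x m.+1 != 0 -> (n <= m)%N.
Proof.
move=> /padic_eq0P x0; rewrite /padic_abs; case: pselect => // x0'.
by case: ex_minnP => n xn nP; exists n.
Qed.

Lemma padic_abs_ge0 x : 0 <= padic_abs x.
Proof.
have [->|/padic_absE[n -> _]] := eqVneq x 0; first by rewrite padic_abs0.
by rewrite invr_ge0 exprn_ge0.
Qed.

Lemma ler_natVX m n : (n <= m)%N -> p%:R ^- m <= p%:R ^- n :> rat.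
Proof.
move=> nm; case: (posnP p) => [p0|p0].
  rewrite p0 -!exprVn invr0 !expr0n; case: n nm => [|n]; case: m => [|m] //=.
by rewrite lef_pV2 ?posrE ?exprn_gt0 ?ltr0n // ler_weXn2l // ler1n.
Qed.

Lemma padic_abs_le x n : x n = 0 -> padic_abs x <= p%:R ^- n.
Proof.
move=> xn; have [->|x0] := eqVneq x 0.
  by rewrite padic_abs0 invr_ge0 exprn_ge0.
have [m -> [xm _]] := padic_absE x0; apply: ler_natVX.
rewrite leqNgt; apply: contra_neqN xm => mn.
by rewrite -(residue_modX x mn) xn mod0z.
Qed.

Lemma padic_abs_eq0 x : padic_abs x = 0 -> x = 0.
Proof.
have [//|x0] := eqVneq x 0; have [n -> [xn nP]] := padic_absE x0.
move/eqP; rewrite invr_eq0 expf_eq0 pnatr_eq0 => /andP[n0 /eqP p0].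
have Pn0 : P n = 0 by rewrite p0 expr0n -[n == 0%N]negbK -lt0n n0.
move: (residueP x n) xn (nP n.-1); rewrite Pn0 modz0 prednK // => -> xn /(_ xn).
by rewrite leqNgt ltn_predL n0.
Qed.

Lemma padic_absN x : padic_abs (- x) = padic_abs x.
Proof.
have H y n : (- y) n != 0 -> y n != 0.
  by apply: contra_neq => yn; rewrite residueN yn oppr0 mod0z.
have [->|x0] := eqVneq x 0; first by rewrite oppr0.
have [n -> [xn nP]] := padic_absE x0.
have [|m -> [xm mP]] := @padic_absE (- x); first by rewrite oppr_eq0.
suff -> : n = m by [].
apply/eqP; rewrite eqn_leq nP ?mP //; last exact: H.
by apply: H; rewrite opprK.
Qed.

Lemma padic_abs_ultra x y :
  padic_abs (x + y) <= Num.max (padic_abs x) (padic_abs y).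
Proof.
have [->|xy0] := eqVneq (x + y) 0.
  by rewrite padic_abs0 le_max padic_abs_ge0.
have [n -> [xyn _]] := padic_absE xy0.
have H z : z n.+1 != 0 -> p%:R ^- n <= padic_abs z.
  move=> zn; have /padic_absE[m -> [_ mP]] : z != 0.
    by apply/padic_eq0P; exists n.
  exact/ler_natVX/mP.
rewrite le_max; have [x0|/H->//] := eqVneq (x n.+1) 0.
have [y0|/H->] := eqVneq (y n.+1) 0; last by rewrite orbT.
by move: xyn; rewrite residueD x0 y0 addr0 mod0z eqxx.
Qed.

Definition padic_dist x y : rat := padic_abs (x - y).

Lemma padic_distxx x : padic_dist x x = 0.
Proof. by rewrite /padic_dist subrr padic_abs0. Qed.

Lemma padic_dist_eq0 x y : padic_dist x y = 0 -> x = y.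
Proof. by move/padic_abs_eq0/eqP; rewrite subr_eq0 => /eqP. Qed.

Lemma padic_distC x y : padic_dist x y = padic_dist y x.
Proof. by rewrite /padic_dist -padic_absN opprB. Qed.

Lemma padic_dist_triangle y x z :
  padic_dist x z <= padic_dist x y + padic_dist y z.
Proof.
rewrite /padic_dist -[x in x - z](subrK y) -addrA.
apply: le_trans (padic_abs_ultra _ _) _.
by rewrite ge_max lerDl lerDr !padic_abs_ge0.
Qed.

HB.instance Definition _ := isMetric.Build rat (padic_int p)
  padic_distxx padic_dist_eq0 padic_distC padic_dist_triangle.

Definition padic_digit x i : int := (x i.+1 %/ P i)%Z.

Lemma padic_of_digits_subproof (b : nat -> int) n :
  (\sum_(i < n.+1) b i * P i = \sum_(i < n) b i * P i %[mod P n])%Z.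
Proof. by rewrite big_ord_recr /= addrC modzMDl. Qed.

(* \sum_i b_i p^i for arbitrary integers b_i; see [padic_of_digits_cvg]. *)
Definition padic_of_digits (b : nat -> int) : padic_int p :=
  padic_of_coherent (padic_of_digits_subproof b).

Lemma padic_digit_range x i :
  (0 < p)%N -> 0 <= padic_digit x i < p%:Z.
Proof.
move=> p0; have Pi : 0 < P i by rewrite exprn_gt0.
rewrite divz_ge0 // ltz_divLR // -exprS -(residue_mod x i.+1).
by rewrite modz_ge0 ?ltz_pmod ?gt_eqF // exprn_gt0.
Qed.

Lemma padic_digitK x : padic_of_digits (padic_digit x) = x.
Proof.
apply: padic_ext => n /=; rewrite -[RHS]residue_mod; congr (_ %% _)%Z.
elim: n => [|n IHn].
  by rewrite big_ord0 -(residueP x 0) expr0 modz1.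
by rewrite big_ord_recr /= IHn -(residueP x n) addrC -divz_eq.
Qed.

Lemma padic_of_digits_cvg (b : nat -> int) : (1 < p)%N ->
  series (fun i => (b i)%:~R * p%:R ^+ i) @ \oo --> padic_of_digits b.
Proof.
move=> p1; apply/metricType_numDomainType.cvgrPdist_lt => e e0.
have p0 : (0 < p%:R :> rat) by rewrite ltr0n ltnW.
pose m := Num.bound e^-1; have me : p%:R ^- m < e.
  rewrite invf_plt ?posrE ?exprn_gt0 //.
  apply: lt_le_trans (archi_boundP _) _; first by rewrite invr_ge0 ltW.
  by rewrite -natrX ler_nat ltnW // ltn_expl.
exists m => // N /= mN; apply: le_lt_trans me; apply: padic_abs_le.
have -> : series (fun i => (b i)%:~R * p%:R ^+ i : padic_int p) N =
    (\sum_(i < N) b i * P i)%:~R.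
  rewrite /series /= big_mkord rmorph_sum; apply: eq_bigr => i _.
  by rewrite rmorphM rmorphXn.
rewrite residueB residue_int -[X in X - _](residue_modX _ mN) /=.
by rewrite modz_modX // subrr mod0z.
Qed.

Definition padic_shift x : padic_int p :=
  padic_of_digits (fun i => padic_digit x i.+1).

(* x(x-1)...(x-n+1) / n!, where the quotient is taken in Z_p; for p prime
   it exists ([padic_binomP]) and is unique ([padic_mul_fact_inj]). *)
Definition padic_binom x n : padic_int p :=
  xget 0 [set y | n`!%:R * y = \prod_(i < n) (x - i%:R)].

Lemma ffactz (X n : nat) : (X ^_ n)%:Z = \prod_(i < n) (X%:Z - i%:Z).
Proof.
elim: n => [|n IHn]; first by rewrite big_ord0.
rewrite big_ord_recr /= -IHn ffactnSr PoszM.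
by case: (leqP n X) => [/subzn->|/ffact_small->]; rewrite ?mul0r.
Qed.

Lemma residue_prod x n k :
  (\prod_(i < n) (x - i%:R)) k = ((\prod_(i < n) (x k - i%:Z)) %% P k)%Z.
Proof.
elim: n => [|n IHn]; first by rewrite !big_ord0.
rewrite !big_ord_recr residueM IHn residueB residue_nat modzMml.
by rewrite modzMmr -modzMmr -modzDmr modzNm modzDmr modzMmr.
Qed.

Lemma fact_cancel n m (a : int) : prime p ->
  (P (m + logn p n`!) %| n`!%:Z * a)%Z -> (P m %| a)%Z.
Proof.
move=> p_pr; rewrite -[X in Posz X * _](partnC p (fact_gt0 n)) p_part.
set u := (n`!`_p^')%N; have cop : coprimez (P m) u%:Z.
  rewrite -(rmorphXn Posz) /coprimez /gcdz !absz_nat eqz_nat.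
  by apply: (@pnat_coprime p); rewrite ?part_pnat // pnatX pnat_id.
have Pv0 : P (logn p n`!) != 0 by rewrite expf_neq0 // eqz_nat -lt0n prime_gt0.
by rewrite PoszM -mulrA rmorphXn /= exprD [P m * _]mulrC dvdz_mul2l // Gauss_dvdzr.
Qed.

Lemma residue_ge0 x n : (0 < p)%N -> 0 <= x n.
Proof.
by move=> p0; rewrite -(residue_mod x n) modz_ge0 // gt_eqF // exprn_gt0.
Qed.

Lemma padic_mul_fact_inj n : prime p ->
  injective (fun x => n`!%:R * x : padic_int p).
Proof.
move=> p_pr x y xy; apply/eqP; rewrite -subr_eq0; apply/eqP/padic_ext => m.
rewrite residue0 -(residue_modX _ (leq_addr (logn p n`!) m)).
apply/dvdz_mod0P/(@fact_cancel n) => //.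
apply/dvdz_mod0P; rewrite -modzMml -residue_nat -residueM.
by rewrite mulrBr xy subrr residue0.
Qed.

Lemma padic_binomP x n : prime p ->
  n`!%:R * padic_binom x n = \prod_(i < n) (x - i%:R).
Proof.
move=> p_pr; pose v := logn p n`!; pose c m := 'C(`|x (m + v)%N|, n)%:Z.
have cE m : (n`!%:Z * c m = (\prod_(i < n) (x - i%:R)) (m + v)%N
             %[mod P (m + v)])%Z.
  rewrite /c -PoszM mulnC bin_ffact ffactz gez0_abs ?residue_ge0 ?prime_gt0 //.
  by rewrite residue_prod modz_mod.
have cP m : (c m.+1 = c m %[mod P m])%Z.
  apply/eqP; rewrite eqz_mod_dvd; apply: (@fact_cancel n) => //.
  rewrite mulrBr -eqz_mod_dvd cE -(modz_modX _ (leqnSn _)) cE modz_modX //.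
  by rewrite residue_eqmod.
suff ex : n`!%:R * padic_of_coherent cP = \prod_(i < n) (x - i%:R).
  by rewrite /padic_binom; set A := [set y | _]; exact: (@xgetI _ 0 A _ ex).
apply: padic_ext => m.
rewrite residueM residue_nat modzMml -[residue (padic_of_coherent _) _]/(_ %% _)%Z.
rewrite modzMmr -(modz_modX _ (leq_addr v m)) cE.
by rewrite modz_modX ?leq_addr // residue_modX ?leq_addr.
Qed.

Definition padic_dvd x y := exists z, y = z * x.

Definition mahler_expansion (T : padic_int p -> padic_int p)
    (a : nat -> padic_int p) :=
  forall x, series (fun n => a n * padic_binom x n) @ \oo --> T x.

End PadicInt.

(* Main.v *)
Require Import Defs.
From mathcomp Require Import all_boot all_order all_algebra.
From mathcomp Require Import all_classical all_reals all_analysis.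
From mathcomp Require Import zify.

(** Write [q = p ^ k]. On natural numbers the Mahler series is a finite sum, so
    [S^k m = \sum_n a n * 'C(m, n)]; and [S^k m = m %/ q], because a shift drops
    the lowest base-[p] digit. Thus [a] is the inverse binomial transform of
    [f m = m %/ q], and everything follows from the functional equation
    [f (m + q) = f m + 1].

    Since [f] vanishes on [0, q), so do its first [q] coefficients, and then
    [f q = 1] reads [a q = 1]. Expanding [f (m + q)] by Vandermonde's identity
    (in operator terms, [E ^ q = (1 + Delta) ^ q]; [binomial_transform_addn])
    and comparing coefficients turns the functional equation into
      [\sum_(1 <= i <= q) 'C(q, i) a (n + i) = 0]   for [n > 0].
    The coefficient of [a (n + q)] is [1], and [p] divides all the others.
    Hence if [p ^ j] divides the [q - 1] terms that precede [a (n + q)], then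
    [p ^ j.+1] divides [a (n + q)]: each further factor [p] costs [q - 1]
    indices ([dvd_binomial_recurrence]). *)

Import Order.TTheory GRing.Theory Num.Theory.
Local Open Scope classical_set_scope.
Local Open Scope ring_scope.

(** * Binomial transforms *)

Definition binomial_transform {V : zmodType} (u : nat -> V) (m : nat) : V :=
  \sum_(n < m.+1) u n *+ 'C(m, n).

(** Pascal's rule. *)
Lemma binomial_transformS {V : zmodType} (u : nat -> V) m :
  binomial_transform u m.+1 = binomial_transform (fun n => u n + u n.+1) m.
Proof.
rewrite /binomial_transform big_ord_recl bin0.
under eq_bigr => i _ do rewrite lift0 binS mulrnDr.
rewrite big_split /= addrA.
under [RHS]eq_bigr => i _ do rewrite mulrnDl.
rewrite big_split /=; congr (_ + _).
rewrite big_ord_recr /= bin_small // mulr0n addr0 [RHS]big_ord_recl bin0.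
by congr (_ + _); apply: eq_bigr => i _; rewrite lift0.
Qed.

(** Vandermonde's identity, read on transforms: translating [m] by [q] replaces
    the coefficient [u n] by the transform at [q] of the tail of [u] from [n]. *)
Lemma binomial_transform_addn {V : zmodType} (u : nat -> V) m q :
  binomial_transform u (m + q) =
  binomial_transform (fun n => binomial_transform (fun i => u (n + i)%N) q) m.
Proof.
elim: q m => [|q IHq] m.
  rewrite addn0; apply: eq_bigr => n _.
  by rewrite [in RHS]/binomial_transform big_ord1 bin0 addn0.
rewrite addnS -addSn IHq binomial_transformS.
apply: eq_bigr => n _; congr (_ *+ _); rewrite binomial_transformS.
rewrite /binomial_transform -big_split /=; apply: eq_bigr => i _.
by rewrite addSn addnS mulrnDl.
Qed.

(** The transform is unitriangular, so values below [N] determine the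
    coefficients below [N]. *)
Lemma binomial_transform_inj {V : zmodType} (u v : nat -> V) N :
  (forall m, (m < N)%N -> binomial_transform u m = binomial_transform v m) ->
  forall n, (n < N)%N -> u n = v n.
Proof.
move=> uv; elim/ltn_ind => n IHn ltnN.
have := uv n ltnN; rewrite /binomial_transform !big_ord_recr /= binn.
rewrite (eq_bigr (fun i : 'I_n => v i *+ 'C(n, i))) => [/addrI//|i _].
by rewrite IHn // (ltn_trans (ltn_ord i)).
Qed.

(** * Divisibility *)

(** From [i * 'C(p ^ k, i) = p ^ k * 'C(p ^ k - 1, i - 1)]: if ['C(p ^ k, i)]
    were prime to [p], then [p ^ k] would divide [i], which is smaller. *)
Lemma prime_dvd_bin_expn p k i : prime p -> (0 < i < p ^ k)%N ->
  (p %| 'C(p ^ k, i))%N.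
Proof.
move=> p_pr /andP[]; case: i => // i _ ltiq.
apply: contraLR ltiq => ndvd; rewrite -leqNgt dvdn_leq //.
have co : coprime (p ^ k) 'C(p ^ k, i.+1) by rewrite coprimeXl // prime_coprime.
by rewrite -(Gauss_dvdl _ co) -mul_bin_diag dvdn_mulr.
Qed.

(** In the recurrence the term [a n] of the transform cancels, and the last one,
    [a (n + q)], has coefficient [1]; the [q - 1] terms in between carry a factor
    [p]. So divisibility by [p ^ j] past some index gives divisibility by
    [p ^ j.+1] once all the intermediate terms are past that index, [q - 1]
    steps later. The offset [1] in the bound is there because the recurrence
    starts at [n = 1], so that [a (q + 1)] is the first term it controls. *)
Lemma dvd_binomial_recurrence {R : comPzRingType} (p q : nat) (a : nat -> R) :
  (0 < q)%N ->
  (forall i, (0 < i < q)%N -> (p %| 'C(q, i))%N) ->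
  (forall n, (0 < n)%N -> binomial_transform (fun i => a (n + i)%N) q = a n) ->
  forall j n, (j * q - j + 1 < n)%N -> exists z, a n = z * p%:R ^+ j.
Proof.
case: q => // q _ dvd_bin rec.
have bound j : (j * q.+1 - j = j * q)%N by rewrite mulnS addKn.
elim=> [|j IHj] n; rewrite bound => lt_n.
  by exists (a n); rewrite expr0 mulr1.
have [m m_gt0 nE] : exists2 m, (0 < m)%N & n = (m + q.+1)%N.
  by exists (n - q.+1)%N; move: lt_n; rewrite mulSn; lia.
have lt_m i : (j * q.+1 - j + 1 < m + i.+1)%N.
  by rewrite bound; move: lt_n; rewrite nE mulSn; lia.
(* The recurrence is solved for its last term, which is [a n]. *)
have -> : a n = - \sum_(i < q) a (m + i.+1)%N *+ 'C(q.+1, i.+1).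
  have := rec m m_gt0; rewrite /binomial_transform big_ord_recl big_ord_recr /=.
  rewrite bin0 addn0 binn -nE !mulr1n -[X in _ = X]addr0 => /addrI/eqP.
  by rewrite addrC addr_eq0 => /eqP.
suff [z ->] : exists z,
    \sum_(i < q) a (m + i.+1)%N *+ 'C(q.+1, i.+1) = z * p%:R ^+ j.+1.
  by exists (- z); rewrite mulNr.
apply: (big_ind (fun x => exists z, x = z * p%:R ^+ j.+1)).
- by exists 0; rewrite mul0r.
- by move=> _ _ [y ->] [z ->]; exists (y + z); rewrite mulrDl.
move=> i _; have [z ->] := IHj _ (lt_m i).
have /dvdnP[c ->] : (p %| 'C(q.+1, i.+1))%N 
  by apply: dvd_bin; rewrite /= ltnS ltn_ord.
by exists (z * c%:R); rewrite -[LHS]mulr_natr natrM exprSr mulrACA.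
Qed.

(** * The shift on natural numbers *)

Section NaturalArguments.
Variables (p : nat) (p_prime : prime p).

(** The digits of [padic_shift x] modulo [p ^ n] are those of [x] modulo
    [p ^ n.+1] without the lowest, and dropping the lowest digit is the integer
    division by [p]. *)
Lemma residue_padic_shift (x : padic_int p) n :
  padic_shift x n = (x n.+1 %/ p%:Z)%Z.
Proof.
have p_gt0 : 0 < p%:Z :> int by rewrite ltz_nat prime_gt0.
have P_gt0 i : 0 < p%:Z ^+ i by rewrite exprn_gt0.
have x_bounds i : 0 <= x i < p%:Z ^+ i.
  by rewrite -(residue_mod x i) modz_ge0 ?gt_eqF // ltz_pmod.
suff digitsE : \sum_(i < n) padic_digit x i.+1 * p%:Z ^+ i = (x n.+1 %/ p%:Z)%Z.
  have /andP[x_ge0 x_lt] := x_bounds n.+1.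
  rewrite /= digitsE modz_small // divz_ge0 // x_ge0 ltz_divLR //.
  by rewrite -exprSr.
elim: n => [|n IHn].
  by rewrite big_ord0 divz_small //; exact: (x_bounds 1%N).
rewrite big_ord_recr /= IHn -(residueP x n.+1) /padic_digit.
rewrite [in RHS](divz_eq (x n.+2) (p%:Z ^+ n.+1)) exprSr.
by rewrite mulrA divzMDl ?gt_eqF // addrC.
Qed.

Lemma padic_shift_nat m : padic_shift m%:R = (m %/ p)%:R :> padic_int p.
Proof.
apply: padic_ext => n; rewrite residue_padic_shift !residue_nat.
by rewrite -!rmorphXn /= !modz_nat divz_nat modn_divl -expnSr.
Qed.

Lemma iter_padic_shift_nat k m :
  iter k (@padic_shift p) m%:R = (m %/ p ^ k)%:R.
Proof.
elim: k => [|k IHk]; first by rewrite divn1.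
by rewrite iterS IHk padic_shift_nat -divnMA -expnSr.
Qed.

Lemma padic_binom_nat m n : padic_binom m%:R n = 'C(m, n)%:R :> padic_int p.
Proof.
apply: (@padic_mul_fact_inj p n) => //.
rewrite /= (padic_binomP _ _ p_prime) -natrM mulnC bin_ffact [RHS]pmulrn ffactz.
by rewrite rmorph_prod; apply: eq_bigr => i _; rewrite rmorphB.
Qed.

(** At a natural number the series is a finite sum, since ['C(m, n) = 0] for
    [n > m]. *)
Lemma mahler_expansion_nat (T : padic_int p -> padic_int p) a m :
  mahler_expansion T a -> T m%:R = binomial_transform a m.
Proof.
move=> /(_ m%:R); set s := series _ => cvgT.
suff cvgB : s @ \oo --> binomial_transform a m.
  have hausd : hausdorff_space (padic_int p) by exact: (@metric_hausdorff rat).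
  exact: (@cvg_unique _ hausd (s @ \oo) _ _ _ cvgT cvgB).
apply: cvg_near_cst; exists m.+1 => // N /= ltmN.
rewrite /s /series /= (big_cat_nat _ ltmN) //= big_mkord.
rewrite [X in _ + X]big_nat [X in _ + X]big1 => [|n /andP[ltmn _]].
  by rewrite addr0; apply: eq_bigr => n _; rewrite padic_binom_nat mulr_natr.
by rewrite padic_binom_nat bin_small // mulr0.
Qed.

End NaturalArguments.

Theorem theorem3p2 (p k : nat) (p_prime : prime p) (k_ge1 : (1 <= k)%N)
    (a : nat -> padic_int p)
    (a_mahler : mahler_expansion (iter k (@padic_shift p)) a) :
  [/\ forall n : nat, (n < p ^ k)%N -> a n = 0,
      a (p ^ k)%N = 1
    & forall j n : nat, (j * p ^ k - j + 1 < n)%N ->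
        padic_dvd (p%:R ^+ j) (a n) /\ padic_abs (a n) <= (p%:R ^+ j)^-1].
Proof.
have q_gt0 : (0 < p ^ k)%N by rewrite expn_gt0 prime_gt0.
have transf m : binomial_transform a m = (m %/ p ^ k)%:R.
  by rewrite -(mahler_expansion_nat p p_prime _ _ _ a_mahler) iter_padic_shift_nat.
have a_eq0 n : (n < p ^ k)%N -> a n = 0.
  apply: (binomial_transform_inj a (fun=> 0)) => m ltmq.
  rewrite transf divn_small // [RHS]big1 // => i _; exact: mul0rn.
(* The right-hand side is the sequence whose transform is [f m + 1], where [f]
   is the transform of [a]; the left-hand side is the one whose transform is
   [f (m + p ^ k)]. *)
have rec n : binomial_transform (fun i => a (n + i)%N) (p ^ k) =
             a n + (n == 0)%N%:R.
  pose tail n := binomial_transform (fun i => a (n + i)%N) (p ^ k).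
  apply: (binomial_transform_inj tail (fun n => a n + (n == 0)%N%:R) n.+1) => //.
  move=> m _.
  rewrite -binomial_transform_addn transf divnDr // divnn q_gt0 natrD -transf.
  rewrite {2}/binomial_transform.
  under eq_bigr => i _ do rewrite mulrnDl.
  rewrite big_split /=; congr (_ + _).
  by rewrite big_ord_recl bin0 big1 ?addr0 // => i _; exact: mul0rn.
split=> //.
  have := transf (p ^ k)%N; rewrite divnn q_gt0 /binomial_transform big_ord_recr.
  by rewrite /= binn big1 ?add0r // => i _; rewrite a_eq0 // mul0rn.
move=> j n lt_n.
have [z az] : exists z, a n = z * p%:R ^+ j.
  apply: (dvd_binomial_recurrence p (p ^ k)) lt_n => // [i|m m_gt0].
    exact: prime_dvd_bin_expn.
  by rewrite rec (gtn_eqF m_gt0) addr0.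
split; first by exists z.
apply: padic_abs_le.
by rewrite az residueM -natrX residue_nat -rmorphXn modzz mulr0 mod0z.
Qed.
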